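(* Let $V$ be a finite set of nodes, every node having degree bound $1$, and let $\mathcal S$ be a finite set of jobs, each job $i$ given by a source $u_i\in V$, a destination $v_i\in V$, size $1$, weight $1$ and a release time $r_i\in\mathbb{N}$. Let $ALG(s)$ be the total flow time $\sum_{i\in\mathcal S}(C_i-r_i)$ of the release-time-ordered greedy maximal matching algorithm (described in the context) run with speed $s$, where $C_i$ is the completion time of job $i$. Let $OPT$ be the optimal total flow time achievable by any schedule with speed $1$. Then for every $\epsilon>0$, $$ALG(2+\epsilon)\le \frac{2(2+\epsilon)}{\epsilon}\cdot OPT.$$
   Context: Time is slotted. In each time slot $t$ a (speed-$1$) schedule chooses a set of released, uncompleted jobs forming a matching on $V$ (each job is an edge $\{u_i,v_i\}$, and each node is an endpoint of at most one chosen job); each chosen job is completed in that slot. The algorithm: at each time $t$, let $G(t)$ be the multigraph of all jobs in the system at time $t$ (released at or before $t$ and not yet completed); order these jobs by release time (ties broken arbitrarily but consistently) and greedily build a maximal matching in this order; these jobs are processed at time $t$. Running with speed $s\ge1$ means the algorithm processes jobs $s$ times faster than a speed-$1$ schedule; in particular, in one time step each node can be the endpoint of up to $s$ processed jobs (the greedy rule in release order is applied with this capacity). The flow time of a job is its completion time minus its release time. *)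

(* Defs.v *)
From HB Require Import structures.
From mathcomp Require Import all_boot all_order all_algebra.
From Stdlib Require Classical_Prop.
Set Implicit Arguments.
Unset Strict Implicit.
Unset Printing Implicit Defensive.
Import Order.TTheory GRing.Theory Num.Theory.
Local Open Scope ring_scope.

Section Model.
Variables (V J : finType) (src dst : J -> V) (r : J -> nat).

(* A job with src i = dst i is allowed; it occupies its node once. *)
Definition incident (i : J) (w : V) : bool := (src i == w) || (dst i == w).

Definition is_matching (A : {set J}) : Prop :=
  forall w : V, (#|[set i in A | incident i w]| <= 1)%N.

(* M t is the set of jobs chosen in slot t. *)
Definition is_schedule (M : nat -> {set J}) : Prop :=
  forall t : nat,
    (forall i : J, i \in M t ->
       (r i <= t)%N /\ (forall t' : nat, (t' < t)%N -> i \notin M t')) /\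
    is_matching (M t).

(* Slot t is the time interval [t, t+1], so a job chosen in slot t is
   complete at time t+1; in particular every job is eventually chosen. *)
Definition schedule_completion (M : nat -> {set J}) (C : J -> nat) : Prop :=
  forall i : J, exists2 t : nat, i \in M t & C i = t.+1.

Definition total_flow (R : realFieldType) (C : J -> nat) : R :=
  \sum_(i : J) ((C i)%:R - (r i)%:R).

Definition achievable (R : realFieldType) (c : R) : Prop :=
  exists M C, [/\ is_schedule M, schedule_completion M C & c = total_flow R C].

Definition is_OPT (R : realFieldType) (c : R) : Prop :=
  achievable c /\ (forall c' : R, achievable c' -> c <= c').

(* The consistent tie-breaking rule is the choice of the list. *)
Definition release_order (order : seq J) : Prop :=
  perm_eq order (enum J) /\ sorted (fun i j => (r i <= r j)%N) order.

Section Algorithm.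
Variables (R : realFieldType) (order : seq J).

(* One slot of the greedy rule.  p i is the work left on job i, cap w the
   capacity left at node w; jobs are taken in the order of the list, and each
   gets as much processing as its own remaining work and the capacity left at
   its two endpoints allow.  With unit work and capacity 1 this is the greedy
   maximal matching; with capacity n : nat it takes a job iff fewer than n jobs
   have been taken before it at either endpoint (greedyE_nat below).  With a
   non-integral capacity the fractional part is used to process a job
   partially. *)
Fixpoint greedy (p : J -> R) (cap : V -> R) (js : seq J) : J -> R :=
  if js is i :: js' then
    let x := Num.min (p i) (Num.min (cap (src i)) (cap (dst i))) in
    let cap' := fun w => if incident i w then cap w - x else cap w in
    fun j => if j == i then x else greedy p cap' js' j
  else fun=> 0.

Definition in_system (p : J -> R) (t : nat) (i : J) : bool :=
  (r i <= t)%N && (0 < p i).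

(* Work left on each job at time t, i.e. at the beginning of slot t, when the
   algorithm runs with speed s. *)
Fixpoint remaining (s : R) (t : nat) : J -> R :=
  if t is t'.+1 then
    let p := remaining s t' in
    fun i => p i - greedy p (fun=> s) [seq j <- order | in_system p t' j] i
  else fun=> 1.

Definition alg_completes_at (s : R) (i : J) (t : nat) : Prop :=
  remaining s t i = 0 /\ (forall t' : nat, (t' < t)%N -> 0 < remaining s t' i).

Definition alg_completion (s : R) (C : J -> nat) : Prop :=
  forall i : J, alg_completes_at s i (C i).

End Algorithm.
End Model.

(* The remaining lemmas show that the notions above are well behaved: for a
   natural speed the algorithm is the literal counting rule, and the completion
   times of the algorithm and OPT exist and are unique. *)

Section Sanity.
Variables (V J : finType) (src dst : J -> V) (r : J -> nat).
Variables (R : realFieldType) (order : seq J).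
Local Notation incident := (incident src dst).
Local Notation greedy := (@greedy V J src dst R).
Local Notation rem := (@remaining V J src dst r R order).

Fixpoint greedy_set (n : nat) (A : {set J}) (js : seq J) : {set J} :=
  if js is i :: js' then
    let free := [forall w, incident i w ==>
                   (#|[set j in A | incident j w]| < n)%N] in
    greedy_set n (if free then i |: A else A) js'
  else A.

Lemma greedy_notin p cap js j : j \notin js -> greedy p cap js j = 0.
Proof.
elim: js cap => //= i js IH cap; rewrite inE negb_or => /andP[/negPf-> jjs].
exact: IH.
Qed.

Lemma greedy_set_notin n A js j :
  j \notin js -> (j \in greedy_set n A js) = (j \in A).
Proof.
elim: js A => //= i js IH A; rewrite inE negb_or => /andP[ji jjs].
by rewrite IH //; case: ifP => // _; rewrite !inE (negPf ji).
Qed.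

Lemma greedyE_nat_gen n (p : J -> R) cap (A : {set J}) js :
  uniq js -> (forall i, i \in js -> p i = 1) ->
  (forall i, i \in js -> i \notin A) ->
  (forall w, (#|[set j in A | incident j w]| <= n)%N /\
     cap w = (n - #|[set j in A | incident j w]|)%:R) ->
  forall j, j \notin A -> greedy p cap js j = (j \in greedy_set n A js)%:R.
Proof.
elim: js cap A => [|i js IH] cap A /=; first by move=> _ _ _ _ j /negPf->.
case/andP=> ijs ujs p1 dA hcap j jA.
have iA : i \notin A by apply: dA; rewrite mem_head.
case: (boolP [forall w, incident i w ==>
               (#|[set j in A | incident j w]| < n)%N])
  => [/forallP fr|/forallPn [w]].
- have lt1 w : incident i w -> 1 <= cap w.
    move=> iw; have := fr w; rewrite iw /= => lt.
    by have [_ ->] := hcap w; rewrite (ler_nat R 1) subn_gt0.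
  have -> : Num.min (p i) (Num.min (cap (src i)) (cap (dst i))) = 1.
    rewrite p1 ?mem_head // min_l // le_min !lt1 // /incident eqxx ?orbT //.
  case: eqVneq => [->|ji].
    by rewrite greedy_set_notin // setU11.
  apply: IH => // [k kjs|k kjs|w|].
  + by apply: p1; rewrite inE kjs orbT.
  + rewrite !inE negb_or dA ?inE ?kjs ?orbT // andbT.
    by apply: contraNneq ijs => <-.
  + have [le_n ->] := hcap w.
    case: ifP => iw; last first.
      suff -> : [set j0 in i |: A | incident j0 w]
             = [set j0 in A | incident j0 w] by [].
      apply/setP => k; rewrite !inE; case: eqVneq => [->|//].
      by rewrite iw !andbF.
    have -> : [set j0 in i |: A | incident j0 w]
           = i |: [set j0 in A | incident j0 w].
      by apply/setP => k; rewrite !inE; case: eqVneq => [->|//]; rewrite iw.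
    have := fr w; rewrite iw /= => lt.
    rewrite cardsU1 inE (negPf iA) /= add1n; split=> //.
    by rewrite subnS -subn1 [in RHS]natrB ?subn_gt0.
  + by rewrite !inE negb_or ji.
- rewrite negb_imply -leqNgt => /andP[iw ge].
  have c0 w' : 0 <= cap w' by have [_ ->] := hcap w'; rewrite ler0n.
  have cw : cap w = 0.
    have [le ->] := hcap w.
    by have -> : (n - #|[set j in A | incident j w]|)%N = 0%N
      by apply/eqP; rewrite subn_eq0.
  have -> : Num.min (p i) (Num.min (cap (src i)) (cap (dst i))) = 0.
    rewrite p1 ?mem_head //; move: iw cw => /orP[]/eqP-> ->.
      by rewrite (min_l (c0 _)) min_r // ler01.
    by rewrite (min_r (c0 _)) min_r // ler01.
  case: eqVneq => [->|ji].
    by rewrite greedy_set_notin // (negPf iA).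
  apply: IH => // [k kjs|k kjs|w'].
  + by apply: p1; rewrite inE kjs orbT.
  + by apply: dA; rewrite inE kjs orbT.
  + have [le ->] := hcap w'; split=> //.
    by rewrite subr0; case: ifP.
Qed.

Lemma greedyE_nat n (p : J -> R) js :
  uniq js -> (forall i, i \in js -> p i = 1) ->
  forall j, greedy p (fun=> n%:R) js j = (j \in greedy_set n set0 js)%:R.
Proof.
move=> ujs p1 j; apply: greedyE_nat_gen => // [k _|w|]; rewrite ?inE //.
suff -> : [set j0 in set0 | incident j0 w] = set0 by rewrite cards0 subn0.
by apply/setP => k; rewrite !inE.
Qed.

Hypothesis order_perm : perm_eq order (enum J).

Lemma remaining_nat n t i : rem n%:R t i = 0 \/ rem n%:R t i = 1.
Proof.
elim: t i => [|t IH] i /=; first by right.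
set p := rem n%:R t; set js := [seq j <- order | _].
have p1 k : k \in js -> p k = 1.
  rewrite mem_filter => /andP[/andP[_ gt0] _].
  by case: (IH k) gt0 => // ; rewrite -/p => ->; rewrite ltxx.
have [ijs|ijs] := boolP (i \in js); last by rewrite greedy_notin // subr0; exact: IH.
have ujs : uniq js by rewrite filter_uniq // (perm_uniq order_perm) enum_uniq.
rewrite greedyE_nat // p1 //; case: (i \in _); first by left; rewrite subrr.
by right; rewrite subr0.
Qed.

Lemma greedy_bound (p : J -> R) cap js i :
  (forall j, 0 <= p j) -> (forall w, 0 <= cap w) ->
  0 <= greedy p cap js i <= p i.
Proof.
move=> p0; elim: js cap => [|k js IH] cap c0 /=; first by rewrite lexx p0.
set x := Num.min _ _.
case: eqVneq => [->|_]; first by rewrite /x !le_min p0 !c0 /= ge_min lexx.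
apply: IH => w; case: ifP => // kw; rewrite subr_ge0 /x !ge_min.
by case/orP: kw => /eqP->; rewrite lexx ?orbT.
Qed.

Lemma remaining_bound s t i : 0 <= s -> 0 <= rem s t i <= 1.
Proof.
move=> s0; elim: t i => [|t IH] i /=; first by rewrite ler01 lexx.
have p0 j : 0 <= rem s t j by have /andP[] := IH j.
have /andP[g0 gp] := @greedy_bound (rem s t) (fun=> s)
  [seq j <- order | in_system r (rem s t) t j] i p0 (fun=> s0).
rewrite subr_ge0 gp /=; have /andP[_ le1] := IH i.
by rewrite (le_trans _ le1) // gerBl.
Qed.

Lemma remaining_le s t t' i :
  0 <= s -> (t <= t')%N -> rem s t' i <= rem s t i.
Proof.
move=> s0 /subnKC <-; elim: (t' - t)%N => [|d IH]; first by rewrite addn0.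
rewrite addnS /=; apply: le_trans IH; rewrite gerBl.
have p0 j : 0 <= rem s (t + d) j by have /andP[] := remaining_bound (t + d) j s0.
by have /andP[] := greedy_bound [seq j <- order | in_system r (rem s (t + d)) (t + d) j] i p0 (fun=> s0).
Qed.

Lemma alg_completion_exists (s : R) :
  1 <= s -> exists C, alg_completion src dst r order s C.
Proof.
move=> s1; have s0 : 0 <= s by exact: le_trans ler01 s1.
pose T := (\max_(i : J) r i)%N; pose L t := [set i | 0 < rem s t i].
have step d : (#|L (T + d)%N| <= #|J| - d)%N.
  elim: d => [|d IH]; first by rewrite subn0 max_card.
  have sub : L (T + d.+1)%N \subset L (T + d)%N.
    apply/subsetP => i; rewrite !inE => /lt_le_trans; apply.
    by apply: remaining_le => //; rewrite leq_add2l.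
  case E : [seq j <- order | in_system r (rem s (T + d)) (T + d) j] => [|i js].
    have -> : L (T + d.+1)%N = set0; last by rewrite cards0.
    apply/eqP; rewrite -subset0; apply: subset_trans sub _.
    apply/subsetP => i; rewrite inE => gt0.
    have : i \in [::] by rewrite -E mem_filter (perm_mem order_perm) mem_enum andbT
      /in_system gt0 andbT (leq_trans _ (leq_addr _ _)) // leq_bigmax.
    by [].
  have iL : i \in L (T + d)%N.
    have : i \in [seq j <- order | in_system r (rem s (T + d)) (T + d) j]
      by rewrite E mem_head.
    by rewrite mem_filter inE => /andP[/andP[]].
  have iL' : i \notin L (T + d.+1)%N.
    rewrite inE addnS /= E /= eqxx minxx min_l ?subrr ?ltxx //.
    by have /andP[_ /le_trans->] := remaining_bound (T + d)%N i s0.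
  rewrite subnS -ltnS; have : L (T + d.+1)%N \proper L (T + d)%N.
    by apply/properP; split=> //; exists i.
  move/proper_card => lt; have := leq_trans lt IH.
  by case: (#|J| - d)%N => //= m; rewrite ltnS.
have fin i : exists t, rem s t i == 0.
  exists (T + #|J|)%N; have := step #|J|; rewrite subnn leqn0 cards_eq0 => /eqP E.
  have : i \notin L (T + #|J|)%N by rewrite E inE.
  rewrite inE -leNgt => le0; rewrite eq_le le0 /=.
  by have /andP[] := remaining_bound (T + #|J|)%N i s0.
exists (fun i => ex_minn (fin i)) => i; case: ex_minnP => m /eqP m0 min; split=> //.
move=> t' lt; rewrite lt_def; have /andP[-> _] := remaining_bound t' i s0.
by rewrite andbT; apply/negP => /min; rewrite leqNgt lt.
Qed.

Lemma alg_completion_unique (s : R) C C' :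
  alg_completion src dst r order s C ->
  alg_completion src dst r order s C' -> C =1 C'.
Proof.
move=> h h' i; have [z l] := h i; have [z' l'] := h' i.
by case: (ltngtP (C i) (C' i)) => // [/l'|/l]; rewrite ?z ?z' ltxx.
Qed.

Lemma is_OPT_unique (c c' : R) :
  is_OPT src dst r c -> is_OPT src dst r c' -> c = c'.
Proof. by case=> a m [a' m']; apply/eqP; rewrite eq_le m // m'. Qed.

Lemma achievable_exists : exists c : R, achievable src dst r c.
Proof.
pose T := (\max_(i : J) r i)%N.
pose sl (i : J) := (T + enum_rank i)%N.
pose M t := [set i | sl i == t].
exists (total_flow r R (fun i => (sl i).+1)), M, (fun i => (sl i).+1).
split=> // [t|i]; last by exists (sl i); rewrite // inE.
split=> [i|w].
  rewrite inE => /eqP <-; split.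
    by rewrite (leq_trans _ (leq_addr _ _)) // leq_bigmax.
  by move=> t' lt; rewrite inE gtn_eqF.
apply: leq_trans (_ : #|M t| <= 1)%N.
  by apply/subset_leq_card/subsetP => i; rewrite inE => /andP[].
apply/card_le1_eqP => i j; rewrite !inE => /eqP <- /eqP/addnI/val_inj.
by move/enum_rank_inj->.
Qed.

Lemma achievable_nat (c : R) :
  achievable src dst r c -> exists n : nat, c = n%:R.
Proof.
case=> M [C [sM cM ->]]; exists (\sum_i (C i - r i))%N.
rewrite /total_flow natr_sum; apply: eq_bigr => i _; rewrite natrB //.
by have [t iM ->] := cM i; have [/(_ i iM)[/leqW]] := sM t.
Qed.

Lemma is_OPT_exists : exists c : R, is_OPT src dst r c.
Proof.
apply: Classical_Prop.NNPP => nex.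
suff H n : ~ achievable src dst r (n%:R : R).
  have [c ac] := achievable_exists; have [n E] := achievable_nat ac.
  by apply: (H n); rewrite -E.
elim/ltn_ind: n => n IH an; apply: nex; exists n%:R; split=> // c' ac.
have [m E] := achievable_nat ac; rewrite E ler_nat leqNgt; apply/negP => lt.
by apply: (IH m lt); rewrite -E.
Qed.

End Sanity.

(* Main.v *)
Require Import Defs.
From mathcomp Require Import all_boot all_order all_algebra.
Import Order.TTheory GRing.Theory Num.Theory.
Local Open Scope ring_scope.

(** Dual fitting.  Suppose a speed-1 schedule runs job [i] in slot [a i].  In
    every slot from [a i] on that leaves [i] unfinished in the algorithm run
    with speed [s], some endpoint of [i] is saturated by jobs released no later
    than [i], which were already in the system at time [a i].  So the delay of
    [i] past slot [a i] is at most [1 / s] times the number of jobs alive at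
    time [a i], counted once for each endpoint shared with [i].  Summed over
    [i], each alive pair (job [j], endpoint [w]) is charged at most once per
    slot, because the jobs of a slot form a matching; hence
    [ALG <= OPT + (2 / s) ALG], which gives even the ratio [s / (s - 2)]. *)

Section ReleaseOrderedGreedy.
Set Implicit Arguments.
Unset Strict Implicit.
Variables (V J : finType) (src dst : J -> V) (r : J -> nat).
Variables (R : realFieldType) (order : seq J).
Hypothesis order_release : release_order r order.
Local Notation incident := (incident src dst).
Local Notation greedy := (@greedy V J src dst R).
Local Notation rem := (@remaining V J src dst r R order).

(** A job that gets less than [p i] takes all the capacity left at one endpoint when its turn comes.
    Earlier jobs took the rest, and sortedness bounds their release times by [r i]. *)
Lemma greedy_saturates (p : J -> R) cap js i :
  (forall j, 0 <= p j) -> (forall w, 0 <= cap w) ->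
  uniq js -> sorted (fun i j => (r i <= r j)%N) js -> i \in js ->
  greedy p cap js i < p i ->
  exists2 w, incident i w &
    cap w <= \sum_(j | incident j w && (r j <= r i)%N) greedy p cap js j.
Proof.
move=> p0; elim: js cap => // k js IH cap c0 /andP[kjs ujs] srt.
have g0 j : 0 <= greedy p cap (k :: js) j.
  by have /andP[] := greedy_bound src dst (k :: js) j p0 c0.
have [<- _|ki] := eqVneq k i.
  rewrite /= eqxx => lt.
  have [w iw le] : exists2 w, incident k w &
      cap w <= greedy p cap (k :: js) k.
    move: lt; rewrite /= eqxx gt_min ltxx /= => lt.
    rewrite min_r; last exact: ltW.
    case: (leP (cap (src k)) (cap (dst k))) => _.
      by exists (src k); rewrite ?lexx // /Defs.incident eqxx.
    by exists (dst k); rewrite ?lexx // /Defs.incident eqxx orbT.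
  exists w => //; apply: le_trans le _.
  rewrite [leRHS](bigD1 k); last by rewrite /= iw leqnn.
  by rewrite lerDl; apply: sumr_ge0 => j _; apply: g0.
rewrite inE eq_sym (negPf ki) /= => ijs.
rewrite eq_sym (negPf ki); set x := Num.min _ _; set cap' := fun w => _ => lt.
have c0' w : 0 <= cap' w.
  rewrite /cap'; case: ifP => // kw; rewrite subr_ge0 /x !ge_min.
  by case/orP: kw => /eqP->; rewrite lexx ?orbT.
have [w iw le] := IH cap' c0' ujs (path_sorted srt) ijs lt.
exists w => //.
have leki : (r k <= r i)%N.
  have tr : transitive (fun i j : J => (r i <= r j)%N).
    by move=> ? ? ?; apply: leq_trans.
  by have /allP/(_ i ijs) := order_path_min tr srt.
(* If [k] touches [w], the capacity it removed returns as its own term of the sum; otherwise [w] is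
   unaffected. *)
move: le; rewrite {1}/cap'; case: ifP => kw le.
  rewrite (bigD1 k) /=; last by rewrite kw.
  rewrite eqxx -lerBlDl; apply: le_trans le _.
  rewrite (bigD1 k) /=; last by rewrite kw.
  rewrite greedy_notin // add0r le_eqVlt; apply/orP; left; apply/eqP.
  by apply: eq_bigr => j /andP[_ /negPf->].
apply: le_trans le _; rewrite le_eqVlt; apply/orP; left; apply/eqP.
by apply: eq_bigr => j /andP[jw _]; case: eqVneq jw => // ->; rewrite kw.
Qed.

Lemma remaining_before_release s t i : (t <= r i)%N -> rem s t i = 1.
Proof.
elim: t => // t IH lt /=; rewrite greedy_notin ?subr0; first exact: IH (ltnW lt).
by rewrite mem_filter /in_system leqNgt lt.
Qed.

Lemma release_lt_completion (s : R) C i :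
  alg_completion src dst r order s C -> (r i < C i)%N.
Proof.
move=> hC; have [z _] := hC i; rewrite ltnNge; apply/negP => le.
by move/eqP: z; rewrite remaining_before_release // oner_eq0.
Qed.

(** A potential: summing over the endpoints of [i] makes it drop whichever endpoint is saturated,
    which may vary from slot to slot. *)
Definition competing_work (s : R) (i : J) (t : nat) : R :=
  \sum_(w | incident i w) \sum_(j | incident j w && (r j <= r i)%N) rem s t j.

Lemma competing_work_ge0 s i t : 0 <= s -> 0 <= competing_work s i t.
Proof.
move=> s0; apply: sumr_ge0 => w _; apply: sumr_ge0 => j _.
by have /andP[] := remaining_bound src dst r order t j s0.
Qed.

(** Since [i] stays unfinished, one endpoint is saturated and loses work [s]; no other term can
    grow. *)
Lemma competing_work_step s i t :
  0 <= s -> (r i <= t)%N -> 0 < rem s t.+1 i ->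
  s <= competing_work s i t - competing_work s i t.+1.
Proof.
move=> s0 rit gt0; rewrite /competing_work -sumrB.
under eq_bigr => w _ do rewrite -sumrB.
have p0 j : 0 <= rem s t j.
  by have /andP[] := remaining_bound src dst r order t j s0.
have [perm_order srt] := order_release.
set js := [seq j <- order | in_system r (rem s t) t j].
have [||||w iw le] := @greedy_saturates (rem s t) (fun=> s) js i p0 (fun=> s0).
- by rewrite filter_uniq // (perm_uniq perm_order) enum_uniq.
- by apply: sorted_filter srt => ? ? ?; apply: leq_trans.
- rewrite mem_filter (perm_mem perm_order) mem_enum andbT /in_system rit /=.
  by apply: lt_le_trans gt0 _; apply: remaining_le.
- by move: gt0; rewrite /= subr_gt0.
rewrite (bigD1 w) //= -[leLHS]addr0; apply: lerD.
  apply: le_trans le _; rewrite le_eqVlt; apply/orP; left; apply/eqP.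
  by apply: eq_bigr => j _; rewrite opprB addrC subrK.
apply: sumr_ge0 => w' _; apply: sumr_ge0 => j _.
rewrite opprB addrC subrK.
by have /andP[] := greedy_bound src dst js j p0 (fun=> s0).
Qed.

Lemma delay_le_competing_work (s : R) C i t d :
  0 <= s -> alg_completion src dst r order s C ->
  (r i <= t)%N -> (t + d < C i)%N -> s * d%:R <= competing_work s i t.
Proof.
move=> s0 hC; elim: d t => [|d IH] t rit lt.
  by rewrite mulr0 competing_work_ge0.
rewrite -natr1 mulrDr mulr1 -lerBrDr.
apply: le_trans (IH t.+1 (leqW rit) _) _; first by rewrite addSnnS.
rewrite lerBrDr addrC -lerBrDr; apply: competing_work_step => //.
have [_] := hC i; apply; apply: leq_ltn_trans lt.
by rewrite addnS ltnS leq_addr.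
Qed.

Definition conflicts (C : J -> nat) (i : J) (t : nat) : nat :=
  (\sum_(w | incident i w) \sum_(j | incident j w && (r j <= t < C j)) 1)%N.

(** A competitor [j] has at most one unit of work left, none from [C j] on, and is released by
    [r i], hence by [t]. *)
Lemma competing_work_le_conflicts (s : R) C i t :
  0 <= s -> alg_completion src dst r order s C -> (r i <= t)%N ->
  competing_work s i t <= (conflicts C i t)%:R.
Proof.
move=> s0 hC rit; rewrite /conflicts natr_sum; apply: ler_sum => w _.
rewrite natr_sum big_mkcond [leRHS]big_mkcond /=; apply: ler_sum => j _.
have /andP[ge0 le1] := remaining_bound src dst r order t j s0.
case: (incident j w) => //=; case: (leqP (r j) (r i)) => [rji|_].
  rewrite (leq_trans rji rit) /=; case: ltnP => // ge.
  by have [z _] := hC j; rewrite -z remaining_le.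
by case: ifP; rewrite ?ler01.
Qed.

Lemma flow_le (s : R) C i t :
  0 < s -> alg_completion src dst r order s C -> (r i <= t)%N ->
  (C i)%:R - (r i)%:R <= t.+1%:R - (r i)%:R + s^-1 * (conflicts C i t)%:R :> R.
Proof.
move=> s0 hC rit; rewrite addrAC lerD2r.
case: (leqP (C i) t.+1) => [le|lt].
  by rewrite -[leLHS]addr0 lerD ?ler_nat // mulr_ge0 // invr_ge0 ltW.
rewrite -lerBlDl -natrB ?(ltnW lt) // ler_pdivlMl //.
apply: le_trans (competing_work_le_conflicts (ltW s0) hC rit).
(* For the delay [d = C i - t.+1], [t + d] equals [C i - 1], the last time at which [i] has work
   left. *)
apply: (delay_le_competing_work (ltW s0) hC rit).
by rewrite -ltnS -addSn subnKC // ltnW.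
Qed.

(** Double counting: the sum is regrouped by the alive job [j] and its endpoint [w]. *)
Lemma sum_conflicts_le C M (a : J -> nat) :
  is_schedule src dst r M -> (forall i, i \in M (a i)) ->
  (\sum_i conflicts C i (a i) <= \sum_j 2 * (C j - r j))%N.
Proof.
move=> hM Ma.
have -> : (\sum_i conflicts C i (a i) = \sum_j \sum_(w | incident j w)
            \sum_(i | incident i w && (r j <= a i < C j)) 1)%N.
  rewrite /conflicts (exchange_big_dep xpredT) //=.
  rewrite [RHS](exchange_big_dep xpredT) //=; apply: eq_bigr => w _.
  rewrite (exchange_big_dep (incident^~ w)) /=; last by move=> ? ? _ /andP[].
  by apply: eq_bigr => j jw; apply: eq_bigl => i; rewrite jw.
apply: leq_sum => j _.
apply: (@leq_trans (\sum_(w | incident j w) (C j - r j))%N).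
  (* By the matching property, [a] is injective on the jobs at [w], so those charging [j] occupy
     distinct slots of the [C j - r j] in its lifetime. *)
  apply: leq_sum => w _; rewrite sum1_card.
  rewrite cardE -(size_map a) -(size_iota (r j) (C j - r j)).
  apply: uniq_leq_size => [|t /mapP[i]]; last first.
    rewrite mem_enum mem_iota => /andP[_ /andP[le lt]] ->.
    by rewrite le subnKC // ltnW // (leq_ltn_trans le).
  rewrite map_inj_in_uniq ?enum_uniq // => i k.
  rewrite !mem_enum => /andP[iw _] /andP[kw _] eq_a.
  have [_ /(_ w) /card_le1_eqP] := hM (a i).
  by apply; rewrite inE ?Ma ?iw // eq_a Ma kw.
rewrite sum_nat_const leq_mul2r; apply/orP; right.
apply: (@leq_trans #|[set src j; dst j]|); last by rewrite cards2; case: (_ != _).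
by apply/subset_leq_card/subsetP => w; rewrite !inE ![w == _]eq_sym.
Qed.

Lemma total_flow_le (s : R) C M C' :
  0 < s -> alg_completion src dst r order s C ->
  is_schedule src dst r M -> schedule_completion M C' ->
  total_flow r R C <= total_flow r R C' + s^-1 * (2 * total_flow r R C).
Proof.
move=> s0 hC hM hC'.
(* A job chosen in slot [t] completes at [t.+1], so its slot is the predecessor of its completion
   time. *)
have MC' i : i \in M (C' i).-1 by have [t it ->] := hC' i.
have C'_gt0 i : (0 < C' i)%N by have [t _ ->] := hC' i.
have rC' i : (r i <= (C' i).-1)%N by have [/(_ i (MC' i))[]] := hM (C' i).-1.
apply: (@le_trans _ _ (\sum_i ((C' i)%:R - (r i)%:R +
                         s^-1 * (conflicts C i (C' i).-1)%:R))).
  by apply: ler_sum => i _; rewrite -{1}(prednK (C'_gt0 i)) flow_le.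
rewrite big_split /= lerD2l -mulr_sumr ler_wpM2l ?invr_ge0 ?(ltW s0) //.
rewrite -natr_sum; apply: (@le_trans _ _ (\sum_j 2 * (C j - r j))%N%:R).
  by rewrite ler_nat; apply: sum_conflicts_le hM MC'.
rewrite natr_sum mulr_sumr; apply: ler_sum => j _.
by rewrite natrM natrB // ltnW // (release_lt_completion j hC).
Qed.

End ReleaseOrderedGreedy.

Theorem theorem1 (R : realFieldType) (V J : finType) (src dst : J -> V)
    (r : J -> nat) (order : seq J) (horder : release_order r order)
    (eps : R) (heps : 0 < eps)
    (C : J -> nat) (hC : alg_completion src dst r order (2 + eps) C)
    (OPT : R) (hOPT : is_OPT src dst r OPT) :
  total_flow r R C <= 2 * (2 + eps) / eps * OPT.
Proof.
have s0 : 0 < 2 + eps by rewrite addr_gt0.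
have [hach _] := hOPT.
have OPT0 : 0 <= OPT by have [n ->] := achievable_nat hach; apply: ler0n.
have [M [C' [hM hC' eqOPT]]] := hach.
have := total_flow_le horder s0 hC hM hC'; rewrite -eqOPT => le.
(* Multiplying by [s = 2 + eps] and moving [2 * ALG] to the left leaves the coefficient
   [s - 2 = eps]. *)
have {}le : total_flow r R C <= (2 + eps) / eps * OPT.
  rewrite mulrAC ler_pdivlMr //.
  move: le; rewrite -lerBlDr -(ler_pM2l s0) mulrBr mulVKf ?gt_eqF //.
  by rewrite mulrDl addrC addKr mulrC.
(* The claimed bound is twice as large, as [OPT] is nonnegative. *)
apply: le_trans le _; rewrite -[leLHS]mul1r -!mulrA ler_wpM2r ?ler1n //.
by rewrite !mulr_ge0 ?invr_ge0 ?(ltW s0) ?(ltW heps).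
Qed.
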